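(* Let $\mathcal H_\mathrm{S},\mathcal H_\mathrm{M},\mathcal H_\mathrm{R}$ be finite-dimensional Hilbert spaces (system, memory, reservoir). Let $\rho^\mathrm{i}_\mathrm{SM}$ be any density operator on $\mathcal H_\mathrm{S}\otimes\mathcal H_\mathrm{M}$, let $\mathcal H_\mathrm{R}$ denote also a Hermitian Hamiltonian on the reservoir space, $\beta>0$, and $\rho^\mathrm{i}_\mathrm{R}=e^{-\beta\mathcal H_\mathrm{R}}/\mathrm{Tr}\,e^{-\beta\mathcal H_\mathrm{R}}$. Let $U_\mathrm{SR}$ be a unitary on $\mathcal H_\mathrm{S}\otimes\mathcal H_\mathrm{R}$, and set $\rho^\mathrm{f}_\mathrm{SMR}=(U_\mathrm{SR}\otimes 1_\mathrm{M})(\rho^\mathrm{i}_\mathrm{SM}\otimes\rho^\mathrm{i}_\mathrm{R})(U_\mathrm{SR}\otimes 1_\mathrm{M})^\dagger$, with all reduced states at times $\mathrm{i}$ and $\mathrm{f}$ obtained by partial traces. Define the heat $Q_\mathrm{R}=\mathrm{Tr}[(\rho^\mathrm{f}_\mathrm{R}-\rho^\mathrm{i}_\mathrm{R})\mathcal H_\mathrm{R}]$, the unconditional entropy production $\Sigma_\mathrm{S}=\mathcal S(\rho^\mathrm{f}_\mathrm{S})-\mathcal S(\rho^\mathrm{i}_\mathrm{S})+\beta Q_\mathrm{R}$ and the conditional entropy production $\Sigma_\mathrm{S|M}=\mathcal S_\mathrm{S|M}(\mathrm f)-\mathcal S_\mathrm{S|M}(\mathrm i)+\beta Q_\mathrm{R}$,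 where $\mathcal S_\mathrm{S|M}=\mathcal S(\rho_\mathrm{SM})-\mathcal S(\rho_\mathrm{M})$ evaluated at the respective time. Then $\Sigma_\mathrm{S|M}\geq\Sigma_\mathrm{S}\geq 0$.
   Context: $\mathcal S(\rho)=-\mathrm{Tr}\,\rho\ln\rho$ is the von Neumann entropy. The memory does not evolve; only system and reservoir interact through $U_\mathrm{SR}$, and initially the reservoir is uncorrelated with system and memory. *)

(* Defs.v *)
From HB Require Import structures.
From mathcomp Require Import all_boot all_order all_algebra.
From mathcomp Require Import complex mxtens.
From mathcomp Require Import reals sequences exp.
Set Implicit Arguments. Unset Strict Implicit. Unset Printing Implicit Defensive.
Import Order.TTheory GRing.Theory Num.Theory.
Local Open Scope ring_scope.
Local Open Scope complex_scope.

Section QDefs.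
Variable R : realType.
Local Notation C := R[i].

Definition adjmx {m n} (A : 'M[C]_(m, n)) : 'M[C]_(n, m) := (map_mx Num.conj A)^T.

Definition psdmx {n} (A : 'M[C]_n) : Prop :=
  forall v : 'rV[C]_n, 0 <= (v *m A *m adjmx v) 0 0.

Definition density {n} (A : 'M[C]_n) : Prop :=
  A \is hermsymmx /\ psdmx A /\ \tr A = 1.

(* functional calculus of a real function on a Hermitian (normal) matrix,
   via the library's spectral decomposition A = P^-1 diag(d) P, P unitary *)
Definition mxfun {n} (f : R -> R) (A : 'M[C]_n) : 'M[C]_n :=
  invmx (spectralmx A)
    *m diag_mx (map_mx (fun z : C => (f (complex.Re z))%:C) (spectral_diag A))
    *m spectralmx A.

(* von Neumann entropy  S(rho) = - Tr rho ln rho  (the trace is real) *)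
Definition vN_entropy {n} (rho : 'M[C]_n) : R :=
  - complex.Re (\tr (rho *m mxfun (@ln R) rho)).

Definition gibbs {n} (beta : R) (H : 'M[C]_n) : 'M[C]_n :=
  let E := mxfun (fun x => expR (- (beta * x))) H in (\tr E)^-1 *: E.

Definition ptrace2 {m n} (X : 'M[C]_(m * n)) : 'M[C]_m :=
  \matrix_(i, j) \sum_(k < n) X (mxtens_index (i, k)) (mxtens_index (j, k)).
Definition ptrace1 {m n} (X : 'M[C]_(m * n)) : 'M[C]_n :=
  \matrix_(i, j) \sum_(k < m) X (mxtens_index (k, i)) (mxtens_index (k, j)).

(* U_SR (x) 1_M acting on the space (S (x) M) (x) R *)
Definition liftSR {dS dM dR} (U : 'M[C]_(dS * dR)) : 'M[C]_(dS * dM * dR) :=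
  \matrix_(k, l)
    let: (sm, r) := mxtens_unindex k in
    let: (sm', r') := mxtens_unindex l in
    let: (s, mm) := mxtens_unindex sm in
    let: (s', mm') := mxtens_unindex sm' in
    U (mxtens_index (s, r)) (mxtens_index (s', r')) * (mm == mm')%:R.

Definition cond_entropy {dS dM} (rhoSM : 'M[C]_(dS * dM)) : R :=
  vN_entropy rhoSM - vN_entropy (ptrace1 rhoSM).

End QDefs.

(* Main.v *)
(* The difference of the two entropy productions is the loss of mutual
   information between system and memory, so the first inequality says that
   mutual information decreases under the channel rho |-> sum_x A_x rho A_x^*
   that the reservoir induces on the system alone.  This is monotonicity of
   relative entropy.  For rho = P^* diag(p) P and sigma = Q^* diag(q) Q put
   w_ji = |(Q P^* )_ji|^2 and, for 0 < s < 1,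
     G_s(rho, sigma) = sum_ji w_ji p_i^2 / ((1 - s) q_j + s p_i).
   Completing squares,
     G_s = max_X  2 Re Tr X^* rho - (1 - s) Tr X^* sigma X - s Tr X rho X^*,
   and replacing X by its image under the dual (unital) channel increases the
   right-hand side by the Kadison-Schwarz inequality, so G_s decreases under
   channels.  Up to trace terms G_s is (1 - s) times the derivative of
   s |-> sum_ji w_ji p_i ln ((1 - s) q_j + s p_i), whose increment over [0, 1] is
   the relative entropy; the mean value theorem concludes, with no integral
   representation of ln.
   The second inequality is D(U (rho_S (x) tau) U^* || rho_S^f (x) tau) >= 0 for
   the Gibbs state tau, written out with ln tau = - beta H - ln Z. *)
Require Import Defs.
From HB Require Import structures.
From mathcomp Require Import all_boot all_order all_algebra.
From mathcomp Require Import complex mxtens.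
From mathcomp Require Import boolp topology normedtype derive realfun.
From mathcomp Require Import reals sequences exp.
From mathcomp Require Import ring lra.
Import Order.TTheory GRing.Theory Num.Theory.
Import numFieldNormedType.Exports.
Local Open Scope ring_scope.
Local Open Scope complex_scope.

Section EntropyProduction.
Set Implicit Arguments. Unset Strict Implicit. Unset Printing Implicit Defensive.
Variable R : realType.
Local Notation C := R[i].
Local Notation "A ^!" := (adjmx A) (format "A ^!").

(** * A scalar comparison *)

Lemma is_derive_sum_seq (I : Type) (r : seq I) (h : I -> R -> R) (dh : I -> R) (x : R) :
  (forall i, is_derive x 1 (h i) (dh i)) ->
  is_derive x 1 (fun s => \sum_(i <- r) h i s) (\sum_(i <- r) dh i).
Proof.
move=> hd; elim: r => [|i r IH].
  under eq_fun do rewrite big_nil; rewrite big_nil; exact: is_derive_cst.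
by under eq_fun do rewrite big_cons; rewrite big_cons; exact: is_deriveD.
Qed.

Lemma is_derive_ln_affine (p q s : R) : 0 < (1 - s) * q + s * p ->
  is_derive s 1 (fun t => ln ((1 - t) * q + t * p))
    ((p - q) / ((1 - s) * q + s * p)).
Proof.
move=> c0.
have haff : is_derive s 1 (fun t => (1 - t) * q + t * p) (p - q).
  have -> : (fun t => (1 - t) * q + t * p) = (fun t : R => q + (p - q) * t).
    by apply/funext => t; ring.
  have := is_deriveD (is_derive_cst q s 1) (is_deriveZ (p - q) (is_derive_id s (1 : R))).
  by rewrite add0r /GRing.scale /= mulr1.
have := @is_derive1_comp _ (@ln R) _ s _ _ (is_derive1_ln c0) haff.
by rewrite mulrC.
Qed.

(** The difference of the sides is [f 1 - f 0] with [f] the weighted sum of logarithms along the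
    segment from [q] to [p], hence equals [f'(c)] for some [c] in (0, 1). With
    [D_i = (1 - c) q_i + c p_i] one has [(p_i - q_i) / D_i = (p_i / D_i - 1) / (1 - c)], and the
    constant drops out because the signed weights sum to 0. *)
Lemma sum_ln_le (I : finType) (a p q : I -> R) :
  (forall i, 0 < p i) -> (forall i, 0 < q i) -> \sum_i a i = 0 ->
  (forall s : R, 0 < s -> s < 1 ->
     0 <= \sum_i a i * (p i / ((1 - s) * q i + s * p i))) ->
  \sum_i a i * ln (q i) <= \sum_i a i * ln (p i).
Proof.
move=> p0 q0 a0 hs.
pose f s := \sum_i a i * ln ((1 - s) * q i + s * p i).
pose df s := \sum_i a i * ((p i - q i) / ((1 - s) * q i + s * p i)).
have c0 (s : R) i : 0 <= s <= 1 -> 0 < (1 - s) * q i + s * p i.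
  by move=> /andP[s0 s1]; have := p0 i; have := q0 i; nra.
have fd (s : R) : 0 <= s <= 1 -> is_derive s 1 f (df s).
  move=> hs01; apply: is_derive_sum_seq => i.
  exact: (@is_deriveZ _ _ _ _ (a i) _ _ _ (is_derive_ln_affine (c0 s i hs01))).
have [c c01 hc] : exists2 c, c \in `]0, 1[%R & f 1 - f 0 = df c * (1 - 0).
  apply: MVT => //.
    by move=> x; rewrite in_itv /= => /andP[x0 x1]; apply: fd; rewrite !ltW.
  apply: derivable_within_continuous => x; rewrite in_itv /= => hx.
  by have [] := fd _ hx.
move: c01; rewrite in_itv /= => /andP[s0 s1].
rewrite -subr_ge0; have -> : \sum_i a i * ln (p i) - \sum_i a i * ln (q i) = f 1 - f 0.
  by congr (_ - _); apply: eq_bigr => i _; congr (_ * ln _); ring.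
rewrite hc subr0 mulr1.
suff -> : df c = (\sum_i a i * (p i / ((1 - c) * q i + c * p i)) - \sum_i a i) / (1 - c).
  by rewrite a0 subr0 divr_ge0 ?hs // subr_ge0 ltW.
rewrite -sumrB mulr_suml; apply: eq_bigr => i _.
have := c0 c i; rewrite !ltW // => /(_ isT) /lt0r_neq0 ?.
by field; apply/andP; split => //; rewrite subr_eq0 gt_eqF.
Qed.

(** Both sides are merged into one signed family over [I + J]; equality of the two masses makes its
    weights sum to 0, as [sum_ln_le] requires. *)
Lemma sum_relent_le (I J : finType) (w p q : I -> R) (w' p' q' : J -> R) :
  (forall i, 0 <= p i) -> (forall i, 0 <= q i) ->
  (forall j, 0 <= p' j) -> (forall j, 0 <= q' j) ->
  (forall i, q i = 0 -> w i * p i = 0) -> (forall j, q' j = 0 -> w' j * p' j = 0) ->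
  \sum_i w i * p i = \sum_j w' j * p' j ->
  (forall s : R, 0 < s -> s < 1 ->
     \sum_j w' j * (p' j ^+ 2 / ((1 - s) * q' j + s * p' j)) <=
     \sum_i w i * (p i ^+ 2 / ((1 - s) * q i + s * p i))) ->
  \sum_j w' j * p' j * (ln (p' j) - ln (q' j)) <=
  \sum_i w i * p i * (ln (p i) - ln (q i)).
Proof.
move=> p0 q0 p'0 q'0 wq w'q' hw hs.
pose a (k : I + J) := match k with inl i => w i * p i | inr j => - (w' j * p' j) end.
(* Terms of weight 0 may have vanishing eigenvalues; these are reset to 1. *)
pose reg (b x : R) := if b == 0 then 1 else x.
pose P (k : I + J) := reg (a k) (match k with inl i => p i | inr j => p' j end).
pose Q (k : I + J) := reg (a k) (match k with inl i => q i | inr j => q' j end).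
have aE (K : R -> R -> R) k x y : a k * K (reg (a k) x) (reg (a k) y) = a k * K x y.
  by rewrite /reg; case: eqP => // ->; rewrite !mul0r.
have P0 k : 0 < P k.
  rewrite /P /reg; case: eqP => // /eqP; case: k => [i|j] /=; rewrite ?oppr_eq0 mulf_eq0 => /norP[_ h].
    by rewrite lt0r h p0.
  by rewrite lt0r h p'0.
have Q0 k : 0 < Q k.
  rewrite /Q /reg; case: eqP => // h; case: k h => [i|j] /= h; rewrite lt0r ?q0 ?q'0 andbT;
  apply/eqP => /[dup] hq; [move/wq|move/w'q'] => h'; apply: h; by rewrite h' ?oppr0.
have := @sum_ln_le (I + J)%type a P Q P0 Q0.
rewrite -subr_ge0 -sumrB => H.
rewrite -subr_ge0; apply: le_trans (H _ _) _ => {H}.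
- by rewrite big_sumType /= sumrN hw subrr.
- move=> s s0 s1; under eq_bigr do rewrite (aE (fun x y => x / ((1 - s) * y + s * x))).
  rewrite big_sumType /=; under [X in _ + X]eq_bigr do rewrite mulNr.
  rewrite sumrN subr_ge0; have := hs s s0 s1.
  have sqE (x y z : R) : y * (x ^+ 2 / z) = y * x * (x / z) by ring.
  rewrite (eq_bigr _ (fun j _ => sqE _ _ _)) => h; apply: (le_trans h).
  by rewrite (eq_bigr _ (fun j _ => sqE _ _ _)).
under eq_bigr do rewrite -mulrBr (aE (fun x y => ln x - ln y)).
rewrite big_sumType /=; under [X in _ + X <= _]eq_bigr do rewrite mulNr.
by rewrite sumrN.
Qed.

(** * Adjoints and unitary diagonalization *)

Lemma adjmxE m n (A : 'M[C]_(m, n)) i j : A^! i j = conjc (A j i).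
Proof. by rewrite !mxE. Qed.

Lemma adjmx_trmxC m n (A : 'M[C]_(m, n)) : A^! = map_mx Num.conj (A^T).
Proof. by rewrite /adjmx map_trmx. Qed.

Lemma adjmxK m n (A : 'M[C]_(m, n)) : A^!^! = A.
Proof. by apply/matrixP => i j; rewrite !adjmxE conjcK. Qed.

Lemma adjmxM m n p (A : 'M[C]_(m, n)) (B : 'M[C]_(n, p)) :
  (A *m B)^! = B^! *m A^!.
Proof. by rewrite /adjmx map_mxM trmx_mul. Qed.

Lemma adjmxB m n (A B : 'M[C]_(m, n)) : (A - B)^! = A^! - B^!.
Proof. by rewrite /adjmx map_mxB raddfB. Qed.

Lemma adjmx_sum m n (I : finType) (F : I -> 'M[C]_(m, n)) :
  (\sum_i F i)^! = \sum_i (F i)^!.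
Proof.
apply: (big_morph (fun A => A^!)) => [A B|]; first by rewrite /adjmx map_mxD raddfD.
by apply/matrixP => i j; rewrite !mxE conjC0.
Qed.

Lemma adjmx1 n : (1%:M : 'M[C]_n)^! = 1%:M.
Proof. by rewrite /adjmx map_mx1 trmx1. Qed.

Lemma adjmx_tens m n p q (A : 'M[C]_(m, n)) (B : 'M[C]_(p, q)) :
  (tensmx A B)^! = tensmx A^! B^!.
Proof. by rewrite /adjmx map_mxT trmx_tens. Qed.

Lemma unitarymx_mulmx n (P : 'M[C]_n) : P \is unitarymx -> P *m P^! = 1%:M.
Proof. by rewrite adjmx_trmxC; move/unitarymxP. Qed.

Lemma unitarymx_adjmul n (P : 'M[C]_n) : P \is unitarymx -> P^! *m P = 1%:M.
Proof. by move/unitarymx_mulmx/mulmx1C. Qed.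

Lemma unitary_of_mulmx n (P : 'M[C]_n) : P *m P^! = 1%:M -> P \is unitarymx.
Proof. by move=> h; apply/unitarymxP; rewrite -adjmx_trmxC. Qed.

Lemma invmx_unitarymx n (P : 'M[C]_n) : P \is unitarymx -> invmx P = P^!.
Proof. by move=> Pu; rewrite invmx_unitary // adjmx_trmxC. Qed.

Lemma Re_sum (I : Type) (r : seq I) (F : I -> C) :
  complex.Re (\sum_(i <- r) F i) = \sum_(i <- r) complex.Re (F i).
Proof. by apply: (big_morph (@complex.Re R)) => // -[? ?] [? ?]. Qed.

Lemma ReB (x y : C) : complex.Re (x - y) = complex.Re x - complex.Re y.
Proof. by case: x y => [? ?] []. Qed.

Lemma ReZ (a : R) (x : C) : complex.Re (a%:C * x) = a * complex.Re x.
Proof. by case: x => [? ?] /=; rewrite mul0r subr0. Qed.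

Definition sqnorm (z : C) : R := complex.Re z ^+ 2 + complex.Im z ^+ 2.

Lemma sqnormE (z : C) : (sqnorm z)%:C = z * conjc z.
Proof. by rewrite /sqnorm add_Re2_Im2 sqr_normc. Qed.

Lemma sqnorm_ge0 (z : C) : 0 <= sqnorm z.
Proof. by rewrite addr_ge0 ?sqr_ge0. Qed.

Definition rdiag n (d : 'rV[R]_n) : 'M[C]_n := diag_mx (map_mx (fun x => x%:C) d).

Lemma rdiagE n (d : 'rV[R]_n) i j : rdiag d i j = (d 0 j)%:C *+ (i == j).
Proof. by rewrite !mxE; case: eqP => [->|_] //; rewrite !mulr0n. Qed.

Lemma adj_rdiag n (d : 'rV[R]_n) : (rdiag d)^! = rdiag d.
Proof.
apply/matrixP => i j; rewrite adjmxE !rdiagE eq_sym; case: eqP => [->|_].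
  by rewrite !mulr1n conjc_real.
by rewrite !mulr0n conjc0.
Qed.

Lemma mul_rdiag_mx m n (d : 'rV[R]_n) (A : 'M[C]_(n, m)) i j :
  (rdiag d *m A) i j = (d 0 i)%:C * A i j.
Proof. by rewrite mul_diag_mx !mxE. Qed.

Lemma mul_mx_rdiag m n (d : 'rV[R]_n) (A : 'M[C]_(m, n)) i j :
  (A *m rdiag d) i j = A i j * (d 0 j)%:C.
Proof. by rewrite mul_mx_diag !mxE. Qed.

(** Any eigenbasis is allowed, not only [spectralmx A]: tensor products and unitary conjugates of
    decompositions are then decompositions with known eigenvalues. *)
Definition diagonalizes n (P : 'M[C]_n) (d : 'rV[R]_n) (A : 'M[C]_n) :=
  P \is unitarymx /\ A = P^! *m rdiag d *m P.

Lemma diagonalizesE n (P : 'M[C]_n) d A :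
  diagonalizes P d A -> P *m A *m P^! = rdiag d.
Proof.
case=> Pu ->; rewrite !mulmxA unitarymx_mulmx // mul1mx -mulmxA.
by rewrite unitarymx_mulmx // mulmx1.
Qed.

Lemma hermsymmx_adj n (A : 'M[C]_n) : A \is hermsymmx <-> A^! = A.
Proof.
rewrite adjmx_trmxC; split.
  by move=> /is_hermitianmxP; rewrite expr0 scale1r => <-.
by move=> h; apply/is_hermitianmxP; rewrite expr0 scale1r.
Qed.

Lemma spectral_diagonalizes n (A : 'M[C]_n) : A \is hermsymmx ->
  diagonalizes (spectralmx A) (map_mx (@complex.Re R) (spectral_diag A)) A.
Proof.
move=> hA; split; first exact: spectral_unitarymx.
have /hermitian_normalmx/orthomx_spectralP := hA.
rewrite (invmx_unitarymx (spectral_unitarymx A)) => {1}->.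
congr (_ *m _ *m _); congr diag_mx; apply/rowP => i; rewrite !mxE.
have /mxOverP/(_ 0 i) := hermitian_spectral_diag_real hA.
by move/RRe_real.
Qed.

Lemma diagonalizes_herm n (P : 'M[C]_n) d A : diagonalizes P d A -> A \is hermsymmx.
Proof.
by case=> _ ->; apply/hermsymmx_adj; rewrite !adjmxM adj_rdiag adjmxK !mulmxA.
Qed.

(** The functional calculus does not depend on the eigenbasis. The change of basis [V] intertwines
    the two diagonal matrices, so a nonzero [V i j] forces equal eigenvalues, hence equal values of
    [f], and [V] intertwines the images too. *)
Lemma mxfunE n f (P : 'M[C]_n) d A : diagonalizes P d A ->
  mxfun f A = P^! *m rdiag (map_mx f d) *m P.
Proof.
move=> PdA; have /spectral_diagonalizes := diagonalizes_herm PdA.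
set S := spectralmx A; set e := map_mx _ _ => SeA.
have Su := SeA.1; have Pu := PdA.1.
have -> : mxfun f A = S^! *m rdiag (map_mx f e) *m S.
  rewrite /mxfun (invmx_unitarymx (spectral_unitarymx A)).
  by congr (_ *m _ *m _); congr diag_mx; apply/rowP => i; rewrite !mxE.
set V := S *m P^!.
have comm (g h : 'rV[R]_n) : (forall i j, V i j != 0 -> g 0 i = h 0 j) -> rdiag g *m V = V *m rdiag h.
  move=> H; apply/matrixP => i j; rewrite mul_rdiag_mx mul_mx_rdiag.
  have [->|/H ->] := eqVneq (V i j) 0; by rewrite ?mulr0 ?mul0r // mulrC.
have eV : rdiag e *m V = V *m rdiag d.
  rewrite -(diagonalizesE SeA) -(diagonalizesE PdA) /V -!mulmxA.
  by rewrite (mulmxA S^! S) (unitarymx_adjmul Su) (mulmxA P^! P) (unitarymx_adjmul Pu) !mul1mx.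
have fV : rdiag (map_mx f e) *m V = V *m rdiag (map_mx f d).
  apply: comm => i j V0; have /matrixP/(_ i j) := eV.
  rewrite mul_rdiag_mx mul_mx_rdiag mulrC => /(mulfI V0)/complexI.
  by rewrite !mxE => ->.
have -> : P = V^! *m S.
  by rewrite /V adjmxM adjmxK -mulmxA (unitarymx_adjmul Su) mulmx1.
rewrite adjmxM adjmxK (mulmxA _ V^!) -(mulmxA S^! V) -fV /V adjmxM adjmxK.
rewrite -!mulmxA (mulmxA P^! P) (unitarymx_adjmul Pu) mul1mx (mulmxA S S^!).
by rewrite (unitarymx_mulmx Su) mul1mx.
Qed.

(** * Monotonicity of relative entropy *)

Lemma mxtrace_conj n (P M : 'M[C]_n) : P \is unitarymx -> \tr (P^! *m M *m P) = \tr M.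
Proof. by move=> Pu; rewrite mxtrace_mulC mulmxA (unitarymx_mulmx Pu) mul1mx. Qed.

Lemma mxtrace_adjmul m n (A B : 'M[C]_(m, n)) :
  \tr (A^! *m B) = \sum_j \sum_i conjc (A j i) * B j i.
Proof.
rewrite exchange_big; apply: eq_bigr => i _; rewrite mxE.
by apply: eq_bigr => j _; rewrite adjmxE.
Qed.

(** The function of [X] whose maximum is G_s. For fixed [X] it is real-linear in [(rho, sigma)], so
    a channel can be moved from the states onto [X]. *)
Definition quad_form n (s : R) (X rho sigma : 'M[C]_n) : R :=
  2 * complex.Re (\tr (X^! *m rho))
  - ((1 - s) * complex.Re (\tr (X^! *m sigma *m X))
     + s * complex.Re (\tr (X *m rho *m X^!))).

Lemma Re_conj_mul (y : C) : complex.Re (conjc y * y) = sqnorm y.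
Proof. by rewrite mulrC -sqnormE. Qed.

(** In the two eigenbases the maximization decouples into one scalar quadratic problem per entry of
    [Y]. *)
Lemma quad_form_diag n s (P Q Y rho sigma : 'M[C]_n) p q :
  diagonalizes P p rho -> diagonalizes Q q sigma ->
  quad_form s (Q^! *m Y *m P) rho sigma =
  \sum_j \sum_i (2 * (complex.Re (conjc (Y j i) * (Q *m P^!) j i) * p 0 i)
     - ((1 - s) * q 0 j + s * p 0 i) * sqnorm (Y j i)).
Proof.
move=> Pp Qq; have Pu := Pp.1; have Qu := Qq.1.
have -> : (Q^! *m Y *m P) = Q^! *m (Y *m P) by rewrite mulmxA.
have adjX : (Q^! *m (Y *m P))^! = P^! *m (Y^! *m Q) by rewrite !adjmxM adjmxK mulmxA.
have t1 : \tr ((Q^! *m (Y *m P))^! *m rho) = \tr (Y^! *m (Q *m P^! *m rdiag p)).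
  rewrite adjX {1}Pp.2 -[RHS](mxtrace_conj _ Pu); congr (\tr _).
  by rewrite -!mulmxA.
have t2 : \tr ((Q^! *m (Y *m P))^! *m sigma *m (Q^! *m (Y *m P))) =
    \tr (Y^! *m (rdiag q *m Y)).
  rewrite adjX -[RHS](mxtrace_conj _ Pu) -(diagonalizesE Qq); congr (\tr _).
  by rewrite -!mulmxA.
have t3 : \tr (Q^! *m (Y *m P) *m rho *m (Q^! *m (Y *m P))^!) =
    \tr (Y^! *m (Y *m rdiag p)).
  rewrite adjX [RHS]mxtrace_mulC -[RHS](mxtrace_conj _ Qu) -(diagonalizesE Pp); congr (\tr _).
  by rewrite -!mulmxA.
rewrite /quad_form t1 t2 t3 !mxtrace_adjmul !Re_sum !mulr_sumr -big_split -sumrB /=.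
apply: eq_bigr => j _; rewrite !Re_sum !mulr_sumr -big_split -sumrB /=.
apply: eq_bigr => i _; rewrite !mul_mx_rdiag mul_rdiag_mx.
have e1 (x y : C) (b : R) : complex.Re (x * (y * b%:C)) = complex.Re (x * y) * b.
  by rewrite mulrA mulrC ReZ mulrC.
by rewrite (mulrC (q 0 j)%:C) !e1 !Re_conj_mul; ring.
Qed.

(** For [c > 0] the gap is [|c y - p w|^2 / c]; the two squares given to [nra] are its real and
    imaginary parts. For [c = 0] both sides vanish, division by 0 being 0. *)
Lemma le_square_frac (w y : C) (p c : R) : 0 <= c -> (c = 0 -> p = 0) ->
  2 * (complex.Re (conjc y * w) * p) - c * sqnorm y <= sqnorm w * (p ^+ 2 / c).
Proof.
move=> c0 pc; have [c00|cn0] := eqVneq c 0.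
  by rewrite (pc c00) c00 !(mulr0, mul0r, expr0n) subr0.
have cp : 0 < c by rewrite lt0r cn0.
case: w y => [u v] [a b]; rewrite /sqnorm /= [leRHS]mulrA ler_pdivlMr //.
have := sqr_ge0 (c * a - u * p); have := sqr_ge0 (c * b - v * p); nra.
Qed.

Lemma square_frac_attained (w : C) (p c : R) : (c = 0 -> p = 0) ->
  let y := w * (p / c)%:C in
  2 * (complex.Re (conjc y * w) * p) - c * sqnorm y = sqnorm w * (p ^+ 2 / c).
Proof.
move=> pc; have [c00|cn0] := eqVneq c 0.
  by rewrite /= (pc c00) c00 !(mulr0, mul0r, expr0n) subr0.
by case: w => [u v]; rewrite /sqnorm /=; field.
Qed.

Section QuasiEntropy.
Variables (n : nat) (s : R) (P Q rho sigma : 'M[C]_n) (p q : 'rV[R]_n).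
Hypotheses (Pp : diagonalizes P p rho) (Qq : diagonalizes Q q sigma).
Hypotheses (p0 : forall i, 0 <= p 0 i) (q0 : forall i, 0 <= q 0 i).
Hypotheses (s0 : 0 < s) (s1 : s < 1).

(** This is G_s(rho, sigma). *)
Definition quasi_entropy := \sum_j \sum_i
  sqnorm ((Q *m P^!) j i) * (p 0 i ^+ 2 / ((1 - s) * q 0 j + s * p 0 i)).

Let c_ge0 i j : 0 <= (1 - s) * q 0 j + s * p 0 i.
Proof. by rewrite addr_ge0 // mulr_ge0 ?subr_ge0 // ltW. Qed.

Let c_eq0 i j : (1 - s) * q 0 j + s * p 0 i = 0 -> p 0 i = 0.
Proof.
move/eqP; rewrite paddr_eq0 ?mulr_ge0 ?subr_ge0 ?(ltW s0) ?(ltW s1) // => /andP[_].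
by rewrite mulf_eq0 gt_eqF // => /eqP.
Qed.

Lemma quad_form_le X : quad_form s X rho sigma <= quasi_entropy.
Proof.
have -> : X = Q^! *m (Q *m X *m P^!) *m P.
  rewrite !mulmxA (unitarymx_adjmul Qq.1) mul1mx -mulmxA.
  by rewrite (unitarymx_adjmul Pp.1) mulmx1.
rewrite (quad_form_diag _ _ Pp Qq); apply: ler_sum => j _; apply: ler_sum => i _.
by apply: le_square_frac => //; exact: c_eq0.
Qed.

Lemma quad_form_attained : exists X, quad_form s X rho sigma = quasi_entropy.
Proof.
(* Each entry is the point where the completed square vanishes; the outer factors return from the
   eigenbases. *)
exists (Q^! *m (\matrix_(j, i) ((Q *m P^!) j i *
  (p 0 i / ((1 - s) * q 0 j + s * p 0 i))%:C)) *m P).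
rewrite (quad_form_diag _ _ Pp Qq); apply: eq_bigr => j _; apply: eq_bigr => i _.
rewrite [X in conjc X]mxE [X in sqnorm X]mxE; apply: square_frac_attained; exact: c_eq0.
Qed.
End QuasiEntropy.

Lemma mxtrace_conj_diag m n (Z : 'M[C]_(m, n)) (Q sigma : 'M[C]_n) q :
  diagonalizes Q q sigma ->
  complex.Re (\tr (Z *m sigma *m Z^!)) = \sum_i \sum_j sqnorm ((Z *m Q^!) i j) * q 0 j.
Proof.
case=> _ ->; have -> : Z *m (Q^! *m rdiag q *m Q) *m Z^! =
    (Z *m Q^! *m rdiag q) *m (Z *m Q^!)^! by rewrite adjmxM adjmxK !mulmxA.
rewrite mxtrace_mulC.
rewrite mxtrace_adjmul Re_sum; apply: eq_bigr => i _; rewrite Re_sum.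
by apply: eq_bigr => j _; rewrite mul_mx_rdiag mulrA mulrC ReZ Re_conj_mul mulrC.
Qed.

Lemma mxtrace_conj_ge0 m n (Z : 'M[C]_(m, n)) (Q sigma : 'M[C]_n) q :
  diagonalizes Q q sigma -> (forall j, 0 <= q 0 j) ->
  0 <= complex.Re (\tr (Z *m sigma *m Z^!)).
Proof.
move=> Qq q0; rewrite (mxtrace_conj_diag _ Qq).
by apply: sumr_ge0 => i _; apply: sumr_ge0 => j _; rewrite mulr_ge0 ?sqnorm_ge0.
Qed.

Lemma mxtrace_conjB m n (F G : 'M[C]_(m, n)) (S : 'M[C]_n) :
  \tr ((F - G) *m S *m (F - G)^!) =
  \tr (F *m S *m F^!) - \tr (F *m S *m G^!) - \tr (G *m S *m F^!)
  + \tr (G *m S *m G^!).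
Proof.
have -> : (F - G) *m S *m (F - G)^! =
  F *m S *m F^! - F *m S *m G^! - (G *m S *m F^! - G *m S *m G^!).
  by rewrite adjmxB (mulmxBl F G) mulmxBl !mulmxBr.
have trB (X Y : 'M[C]_m) : \tr (X - Y) = \tr X - \tr Y by exact: raddfB.
by rewrite trB (trB (F *m S *m F^!)) (trB (G *m S *m F^!)) opprB addrA addrAC.
Qed.

(** * Kraus maps, their duals and the Kadison-Schwarz inequality *)

Section Kraus.
Variables (m n : nat) (K : finType) (A : K -> 'M[C]_(m, n)).

Definition kraus (X : 'M[C]_n) : 'M[C]_m := \sum_k A k *m X *m (A k)^!.
Definition kraus_dual (X : 'M[C]_m) : 'M[C]_n := \sum_k (A k)^! *m X *m A k.

Lemma adj_kraus_dual X : (kraus_dual X)^! = kraus_dual X^!.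
Proof.
by rewrite adjmx_sum; apply: eq_bigr => k _; rewrite !adjmxM adjmxK mulmxA.
Qed.

Lemma mxtrace_kraus X Y : \tr (X *m kraus Y) = \tr (kraus_dual X *m Y).
Proof.
rewrite mulmx_sumr mulmx_suml !raddf_sum; apply: eq_bigr => k _ /=.
by rewrite !mulmxA mxtrace_mulC !mulmxA.
Qed.

Hypothesis A_isom : \sum_k (A k)^! *m A k = 1%:M.

Lemma mxtrace_krausT X : \tr (kraus X) = \tr X.
Proof.
rewrite -[kraus X]mul1mx mxtrace_kraus /kraus_dual.
by under eq_bigr do rewrite mulmx1; rewrite A_isom mul1mx.
Qed.

(* The gap is [sum_k Tr (X A_k - A_k Y) sigma (X A_k - A_k Y)^*], with [Y] the
   dual image of [X]. *)
Lemma kraus_schwarz (X : 'M[C]_m) (Q sigma : 'M[C]_n) q :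
  diagonalizes Q q sigma -> (forall j, 0 <= q 0 j) ->
  complex.Re (\tr (kraus_dual X *m sigma *m (kraus_dual X)^!)) <=
  complex.Re (\tr (X *m kraus sigma *m X^!)).
Proof.
move=> Qq q0; set Y := kraus_dual X.
pose Z k := X *m A k - A k *m Y.
suff h : \sum_k \tr (Z k *m sigma *m (Z k)^!) =
         \tr (X *m kraus sigma *m X^!) - \tr (Y *m sigma *m Y^!).
  rewrite -subr_ge0 -ReB -h Re_sum.
  by apply: sumr_ge0 => k _; exact: mxtrace_conj_ge0 Qq q0.
(* Expanding the square gives four sums with signs +, -, -, +. The first is the right-hand trace;
   the other three all collapse to [Tr Y sigma Y^!], the last one by [A_isom]. *)
have t1 : \tr (X *m kraus sigma *m X^!) = \sum_k \tr (X *m A k *m sigma *m (X *m A k)^!).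
  rewrite mulmx_sumr mulmx_suml raddf_sum; apply: eq_bigr => k _ /=.
  by rewrite adjmxM !mulmxA.
have t2 : \tr (Y *m sigma *m Y^!) = \sum_k \tr (X *m A k *m sigma *m (A k *m Y)^!).
  rewrite {1}/Y /kraus_dual !mulmx_suml raddf_sum; apply: eq_bigr => k _ /=.
  by rewrite adjmxM [in RHS]mulmxA [RHS]mxtrace_mulC !mulmxA.
have t3 : \tr (Y *m sigma *m Y^!) = \sum_k \tr (A k *m Y *m sigma *m (X *m A k)^!).
  rewrite {2}/Y adj_kraus_dual mulmx_sumr raddf_sum; apply: eq_bigr => k _ /=.
  by rewrite adjmxM mulmxA mxtrace_mulC !mulmxA.
have t4 : \tr (Y *m sigma *m Y^!) = \sum_k \tr (A k *m Y *m sigma *m (A k *m Y)^!).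
  rewrite -[Y *m _ *m _]mul1mx -A_isom mulmx_suml raddf_sum; apply: eq_bigr => k _ /=.
  by rewrite adjmxM [in RHS]mulmxA [RHS]mxtrace_mulC !mulmxA.
have -> : \tr (X *m kraus sigma *m X^!) - \tr (Y *m sigma *m Y^!) =
  \tr (X *m kraus sigma *m X^!) - \tr (Y *m sigma *m Y^!)
  - \tr (Y *m sigma *m Y^!) + \tr (Y *m sigma *m Y^!) by ring.
rewrite {1}t1 {1}t2 {1}t3 t4 -!sumrB -big_split; apply: eq_bigr => k _ /=.
exact: mxtrace_conjB.
Qed.

(** The linear term is preserved by duality. The two subtracted quadratic terms shrink by
    [kraus_schwarz], used at [X^!] for [sigma] and at [X] for [rho]. *)
Lemma quad_form_kraus s (X : 'M[C]_m) (P Q rho sigma : 'M[C]_n) p q :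
  diagonalizes P p rho -> (forall j, 0 <= p 0 j) ->
  diagonalizes Q q sigma -> (forall j, 0 <= q 0 j) ->
  0 < s -> s < 1 ->
  quad_form s X (kraus rho) (kraus sigma) <= quad_form s (kraus_dual X) rho sigma.
Proof.
move=> Pp p0 Qq q0 s0 s1; rewrite /quad_form lerB //.
  by rewrite adj_kraus_dual mxtrace_kraus.
rewrite lerD // ler_wpM2l ?subr_ge0 ?(ltW s0) ?(ltW s1) //.
  by have := kraus_schwarz X^! Qq q0; rewrite -adj_kraus_dual !adjmxK.
exact: kraus_schwarz Pp p0.
Qed.
End Kraus.

(** * Relative entropy through eigenbases *)

Section Relent.
Variables (n : nat) (P Q rho sigma : 'M[C]_n) (p q : 'rV[R]_n).
Hypotheses (Pp : diagonalizes P p rho) (Qu : Q \is unitarymx).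

(** The relative entropy D(rho || sigma). Since [ln] is finite at 0, this reading needs the support
    of [rho] inside that of [sigma]; later this is stated as the vanishing of the diagonal entries
    of [rho], in the basis [Q], where [q] vanishes. *)
Definition relent := \sum_j \sum_i
  sqnorm ((Q *m P^!) j i) * p 0 i * (ln (p 0 i) - ln (q 0 j)).

Lemma overlap_colsum i : \sum_j sqnorm ((Q *m P^!) j i) = 1.
Proof.
have /matrixP/(_ i i) : (Q *m P^!)^! *m (Q *m P^!) = 1%:M.
  rewrite adjmxM adjmxK -mulmxA (mulmxA Q^! Q) (unitarymx_adjmul Qu) mul1mx.
  exact: unitarymx_mulmx Pp.1.
rewrite !mxE eqxx => /(congr1 (@complex.Re R)) /= <-; rewrite Re_sum.
by apply: eq_bigr => j _; rewrite adjmxE Re_conj_mul.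
Qed.

Lemma overlap_row j : \sum_i sqnorm ((Q *m P^!) j i) * p 0 i =
  complex.Re ((Q *m rho *m Q^!) j j).
Proof.
have -> : Q *m rho *m Q^! = Q *m P^! *m rdiag p *m (Q *m P^!)^!.
  by rewrite adjmxM adjmxK {1}Pp.2 !mulmxA.
rewrite mxE Re_sum; apply: eq_bigr => i _.
by rewrite adjmxE mul_mx_rdiag mulrAC -sqnormE ReZ.
Qed.

Lemma overlap_mass : \sum_j \sum_i sqnorm ((Q *m P^!) j i) * p 0 i = complex.Re (\tr rho).
Proof.
under eq_bigr do rewrite overlap_row; rewrite -Re_sum; congr complex.Re.
rewrite -[RHS]mul1r; transitivity (\tr (Q *m rho *m Q^!)); first by [].
by rewrite mul1r mxtrace_mulC mulmxA (unitarymx_adjmul Qu) mul1mx.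
Qed.

(** This is Tr rho ln rho - Tr rho ln sigma: overlaps sum to 1 over [j], and weighted by [p] they
    sum over [i] to the diagonal of [rho] in the basis [Q]. *)
Lemma relentE : relent = \sum_i p 0 i * ln (p 0 i)
  - \sum_j complex.Re ((Q *m rho *m Q^!) j j) * ln (q 0 j).
Proof.
have <- : \sum_j \sum_i sqnorm ((Q *m P^!) j i) * (p 0 i * ln (p 0 i)) =
    \sum_i p 0 i * ln (p 0 i).
  by rewrite exchange_big; apply: eq_bigr => i _; rewrite -mulr_suml overlap_colsum mul1r.
rewrite -sumrB; apply: eq_bigr => j _; rewrite -overlap_row mulr_suml -sumrB.
by apply: eq_bigr => i _; ring.
Qed.
End Relent.

(** The maximizer [X] for the output pair yields the test matrix [kraus_dual A X] for the input
    pair, so every G_s decreases, and [sum_relent_le] passes to relative entropies. A vanishing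
    diagonal entry is a sum of nonnegative overlap terms, which gives the support conditions
    termwise. *)
Lemma relent_kraus m n (K : finType) (A : K -> 'M[C]_(m, n))
  (P Q rho sigma : 'M[C]_n) (p q : 'rV[R]_n) (P' Q' : 'M[C]_m) (p' q' : 'rV[R]_m) :
  \sum_k (A k)^! *m A k = 1%:M ->
  diagonalizes P p rho -> diagonalizes Q q sigma ->
  diagonalizes P' p' (kraus A rho) -> diagonalizes Q' q' (kraus A sigma) ->
  (forall i, 0 <= p 0 i) -> (forall i, 0 <= q 0 i) ->
  (forall i, 0 <= p' 0 i) -> (forall i, 0 <= q' 0 i) ->
  (forall j, q 0 j = 0 -> complex.Re ((Q *m rho *m Q^!) j j) = 0) ->
  (forall j, q' 0 j = 0 -> complex.Re ((Q' *m kraus A rho *m Q'^!) j j) = 0) ->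
  relent P' Q' p' q' <= relent P Q p q.
Proof.
move=> A1 Pp Qq Pp' Qq' p0 q0 p0' q0' supp supp'.
pose I := ('I_n * 'I_n)%type; pose J := ('I_m * 'I_m)%type.
have := @sum_relent_le I J
  (fun k => sqnorm ((Q *m P^!) k.1 k.2)) (fun k => p 0 k.2) (fun k => q 0 k.1)
  (fun k => sqnorm ((Q' *m P'^!) k.1 k.2)) (fun k => p' 0 k.2) (fun k => q' 0 k.1).
rewrite /relent !pair_bigA /=; apply => //.
- case=> j i /= /supp; rewrite -(overlap_row Q Pp) => /psumr_eq0P; apply => // k _.
  by rewrite mulr_ge0 ?sqnorm_ge0.
- case=> j i /= /supp'; rewrite -(overlap_row Q' Pp') => /psumr_eq0P; apply => // k _.
  by rewrite mulr_ge0 ?sqnorm_ge0.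
- rewrite -(pair_bigA _ (fun j i => sqnorm ((Q *m P^!) j i) * p 0 i)) /=.
  rewrite -(pair_bigA _ (fun j i => sqnorm ((Q' *m P'^!) j i) * p' 0 i)) /=.
  by rewrite (overlap_mass Pp Qq.1) (overlap_mass Pp' Qq'.1) mxtrace_krausT.
move=> s s0 s1.
rewrite -(pair_bigA _ (fun j i => sqnorm ((Q *m P^!) j i) *
  (p 0 i ^+ 2 / ((1 - s) * q 0 j + s * p 0 i)))) /=.
rewrite -(pair_bigA _ (fun j i => sqnorm ((Q' *m P'^!) j i) *
  (p' 0 i ^+ 2 / ((1 - s) * q' 0 j + s * p' 0 i)))) /=.
have [X hX] := quad_form_attained Pp' Qq' p0' q0' s0 s1.
apply: (le_trans _ (quad_form_le Pp Qq p0 q0 s0 s1 (kraus_dual A X))).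
by rewrite -[leLHS]hX; exact: quad_form_kraus Pp p0 Qq q0 s0 s1.
Qed.

(** * Tensor products and partial traces *)

Lemma mxtrace_delta m n i j (M : 'M[C]_(m, n)) : \tr (delta_mx j i *m M) = M i j.
Proof.
rewrite -(mul_delta_mx (0 : 'I_1)) -mulmxA mxtrace_mulC -rowE -colE.
by rewrite /mxtrace big_ord1 !mxE.
Qed.

(** Nondegeneracy of the trace pairing, which lets identities between partial traces be checked by
    duality. *)
Lemma mxtrace_inj m n (M N : 'M[C]_(m, n)) :
  (forall Y, \tr (Y *m M) = \tr (Y *m N)) -> M = N.
Proof. by move=> h; apply/matrixP => i j; rewrite -!mxtrace_delta h. Qed.

Lemma sum_mxtens (V : nmodType) m n (F : 'I_(m * n) -> V) :
  \sum_k F k = \sum_i \sum_j F (mxtens_index (i, j)).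
Proof.
rewrite pair_big; apply: reindex => /=.
by exists (@mxtens_unindex m n) => k _; case: k => *; rewrite ?mxtens_indexK ?mxtens_unindexK.
Qed.

Lemma tensmx11 m n : tensmx (1%:M : 'M[C]_m) (1%:M : 'M[C]_n) = 1%:M.
Proof.
apply/matrixP => i j; case: (mxtens_indexP i) => a b; case: (mxtens_indexP j) => c d.
by rewrite tensmxE !mxE -natrM mulnb (can_eq (@mxtens_indexK m n)).
Qed.

(** The partial trace is dual to tensoring with the identity; later facts on marginals rest on this
    rather than on entries. *)
Lemma mxtrace_ptrace2 m n (Y : 'M[C]_m) (X : 'M[C]_(m * n)) :
  \tr (Y *m ptrace2 X) = \tr (tensmx Y 1%:M *m X).
Proof.
rewrite /mxtrace sum_mxtens; apply: eq_bigr => i _.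
under [RHS]eq_bigr => k _.
  rewrite mxE sum_mxtens.
  under eq_bigr => j _.
    rewrite (bigD1 k) //= big1 ?addr0; last first.
      by move=> l lk; rewrite tensmxE mxE eq_sym (negbTE lk) mulr0 mul0r.
    rewrite tensmxE mxE eqxx mulr1; over.
  over.
rewrite mxE exchange_big; apply: eq_bigr => j _; by rewrite mxE mulr_sumr.
Qed.

Lemma mxtrace_ptrace1 m n (Y : 'M[C]_n) (X : 'M[C]_(m * n)) :
  \tr (Y *m ptrace1 X) = \tr (tensmx 1%:M Y *m X).
Proof.
rewrite /mxtrace sum_mxtens exchange_big; apply: eq_bigr => i _.
under [RHS]eq_bigr => k _.
  rewrite mxE sum_mxtens (bigD1 k) //= [X in _ + X]big1 ?addr0; last first.
    move=> l lk; rewrite big1 // => j _.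
    by rewrite tensmxE mxE eq_sym (negbTE lk) !mul0r.
  under eq_bigr => j _ do rewrite tensmxE mxE eqxx mul1r.
  over.
rewrite mxE exchange_big; apply: eq_bigr => j _; by rewrite mxE mulr_sumr.
Qed.

Lemma ptrace2_conj m n m' n' (F : 'M[C]_(m', m)) (G : 'M[C]_(n', n)) X :
  G^! *m G = 1%:M ->
  ptrace2 (tensmx F G *m X *m (tensmx F G)^!) = F *m ptrace2 X *m F^!.
Proof.
move=> GG; apply: mxtrace_inj => Y.
rewrite mxtrace_ptrace2 adjmx_tens mulmxA mxtrace_mulC !mulmxA !tensmx_mul mulmx1 GG.
by rewrite -mxtrace_ptrace2 [RHS]mxtrace_mulC !mulmxA.
Qed.

Lemma ptrace1_conj m n m' n' (F : 'M[C]_(m', m)) (G : 'M[C]_(n', n)) X :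
  F^! *m F = 1%:M ->
  ptrace1 (tensmx F G *m X *m (tensmx F G)^!) = G *m ptrace1 X *m G^!.
Proof.
move=> FF; apply: mxtrace_inj => Y.
rewrite mxtrace_ptrace1 adjmx_tens mulmxA mxtrace_mulC !mulmxA !tensmx_mul mulmx1 FF.
by rewrite -mxtrace_ptrace1 [RHS]mxtrace_mulC !mulmxA.
Qed.

Lemma mxtrace_tens m n (X : 'M[C]_m) (Y : 'M[C]_n) :
  \tr (tensmx X Y) = \tr X * \tr Y.
Proof.
rewrite /mxtrace sum_mxtens mulr_suml; apply: eq_bigr => i _.
by rewrite mulr_sumr; apply: eq_bigr => j _; rewrite tensmxE.
Qed.

Lemma ptrace2_tens m n (X : 'M[C]_m) (Y : 'M[C]_n) :
  ptrace2 (tensmx X Y) = \tr Y *: X.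
Proof.
apply: mxtrace_inj => Z.
by rewrite mxtrace_ptrace2 tensmx_mul mxtrace_tens mul1mx -scalemxAr mxtraceZ mulrC.
Qed.

Lemma ptrace1_tens m n (X : 'M[C]_m) (Y : 'M[C]_n) :
  ptrace1 (tensmx X Y) = \tr X *: Y.
Proof.
apply: mxtrace_inj => Z.
by rewrite mxtrace_ptrace1 tensmx_mul mxtrace_tens mul1mx -scalemxAr mxtraceZ.
Qed.

Lemma mxtrace_ptrace2T m n (X : 'M[C]_(m * n)) : \tr (ptrace2 X) = \tr X.
Proof. by rewrite -[ptrace2 X]mul1mx mxtrace_ptrace2 tensmx11 mul1mx. Qed.

Lemma mxtrace_ptrace1T m n (X : 'M[C]_(m * n)) : \tr (ptrace1 X) = \tr X.
Proof. by rewrite -[ptrace1 X]mul1mx mxtrace_ptrace1 tensmx11 mul1mx. Qed.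

Lemma herm_ptrace2 m n (X : 'M[C]_(m * n)) : X^! = X -> (ptrace2 X)^! = ptrace2 X.
Proof.
move=> h; apply/matrixP => i j; rewrite adjmxE !mxE rmorph_sum.
by apply: eq_bigr => k _; rewrite -[in RHS]h adjmxE.
Qed.

Lemma herm_ptrace1 m n (X : 'M[C]_(m * n)) : X^! = X -> (ptrace1 X)^! = ptrace1 X.
Proof.
move=> h; apply/matrixP => i j; rewrite adjmxE !mxE rmorph_sum.
by apply: eq_bigr => k _; rewrite -[in RHS]h adjmxE.
Qed.

Definition tens_diag m n (p : 'rV[R]_m) (q : 'rV[R]_n) : 'rV[R]_(m * n) :=
  \row_k (p 0 (mxtens_unindex k).1 * q 0 (mxtens_unindex k).2).

Lemma tens_diagE m n (p : 'rV[R]_m) (q : 'rV[R]_n) i j :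
  tens_diag p q 0 (mxtens_index (i, j)) = p 0 i * q 0 j.
Proof. by rewrite mxE mxtens_indexK. Qed.

Lemma unitary_tens m n (P : 'M[C]_m) (Q : 'M[C]_n) :
  P \is unitarymx -> Q \is unitarymx -> tensmx P Q \is unitarymx.
Proof.
move=> Pu Qu; apply: unitary_of_mulmx.
by rewrite adjmx_tens tensmx_mul (unitarymx_mulmx Pu) (unitarymx_mulmx Qu) tensmx11.
Qed.

Lemma tens_diagonalizes m n (P A : 'M[C]_m) (Q B : 'M[C]_n) p q :
  diagonalizes P p A -> diagonalizes Q q B ->
  diagonalizes (tensmx P Q) (tens_diag p q) (tensmx A B).
Proof.
move=> [Pu ->] [Qu ->]; split; first exact: unitary_tens.
rewrite adjmx_tens -!tensmx_mul; congr (_ *m _ *m _).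
apply/matrixP => i j; case: (mxtens_indexP i) => a b; case: (mxtens_indexP j) => c d.
rewrite tensmxE !rdiagE tens_diagE (can_eq (@mxtens_indexK m n)) xpair_eqE rmorphM.
by case: eqP => _; case: eqP => _; rewrite /= ?mulr1n ?mulr0n ?mulr0 ?mul0r.
Qed.

(** * The channel induced by a reservoir *)

Lemma conjcM (x y : C) : conjc (x * y) = conjc x * conjc y.
Proof. exact: rmorphM. Qed.

(** The block <k| W |b>, an operator on the first factor. *)
Definition slice m n (W : 'M[C]_(m * n)) (k b : 'I_n) : 'M[C]_m :=
  \matrix_(i, j) W (mxtens_index (i, k)) (mxtens_index (j, b)).

Lemma conj_slice m n (W : 'M[C]_(m * n)) (rho : 'M[C]_m) (tau : 'M[C]_n) i j k l :
  (W *m tensmx rho tau *m W^!) (mxtens_index (i, k)) (mxtens_index (j, l)) =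
  \sum_b \sum_d tau b d * (slice W k b *m rho *m (slice W l d)^!) i j.
Proof.
rewrite mxE sum_mxtens exchange_big [RHS]exchange_big; apply: eq_bigr => d _ /=.
under [RHS]eq_bigr do rewrite mxE mulr_sumr.
rewrite [RHS]exchange_big; apply: eq_bigr => c _ /=.
rewrite mxE sum_mxtens mulr_suml.
under [LHS]eq_bigr do rewrite mulr_suml.
rewrite exchange_big; apply: eq_bigr => b _ /=.
rewrite [(_ *m rho) _ _]mxE !mulr_suml mulr_sumr; apply: eq_bigr => a _.
by rewrite tensmxE !adjmxE !mxE; ring.
Qed.

Lemma mulmx_sum_adj m n (I : finType) (S : I -> 'M[C]_(m, n)) (c : I -> C) rho :
  (\sum_b c b *: S b) *m rho *m (\sum_b c b *: S b)^! =
  \sum_b \sum_d (c b * conjc (c d)) *: (S b *m rho *m (S d)^!).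
Proof.
rewrite adjmx_sum !mulmx_suml; apply: eq_bigr => b _.
rewrite mulmx_sumr; apply: eq_bigr => d _.
have -> : (c d *: S d)^! = conjc (c d) *: (S d)^!.
  by apply/matrixP => i j; rewrite !mxE rmorphM.
by rewrite -!scalemxAl -scalemxAr scalerA.
Qed.

(* [sqrt g_r <k| W |e_r>] with [x = (k, r)], where the eigenvector [e_r] of the
   reservoir state is the adjoint of row [r] of [P]. *)
Definition reservoir_kraus m n (W : 'M[C]_(m * n)) (P : 'M[C]_n) (g : 'rV[R]_n)
    (x : 'I_n * 'I_n) : 'M[C]_m :=
  \sum_b ((Num.sqrt (g 0 x.2))%:C * conjc (P x.2 b)) *: slice W x.1 b.

(** Expand [tau b d] as the sum over [r] of [conjc (P r b) * g_r * P r d] and share [g_r] as two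
    square roots between a Kraus operator and its adjoint. *)
Lemma ptrace2_kraus m n (W : 'M[C]_(m * n)) (rho : 'M[C]_m) (P tau : 'M[C]_n) g :
  diagonalizes P g tau -> (forall i, 0 <= g 0 i) ->
  ptrace2 (W *m tensmx rho tau *m W^!) = kraus (reservoir_kraus W P g) rho.
Proof.
move=> Pg g0; apply/matrixP => i j; rewrite mxE summxE.
rewrite -(pair_bigA _ (fun k r => (reservoir_kraus W P g (k, r) *m rho *m
   (reservoir_kraus W P g (k, r))^!) i j)) /=.
apply: eq_bigr => k _; rewrite conj_slice.
under [RHS]eq_bigr => r _.
  rewrite mulmx_sum_adj summxE.
  under eq_bigr do rewrite summxE; over.
rewrite [RHS]exchange_big; apply: eq_bigr => b _ /=.
rewrite [RHS]exchange_big; apply: eq_bigr => d _ /=.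
rewrite Pg.2 mxE mulr_suml; apply: eq_bigr => r _.
rewrite mul_mx_rdiag adjmxE [RHS]mxE conjcM conjcK conjc_real.
rewrite -{1}(sqr_sqrtr (g0 r)) expr2 rmorphM; ring.
Qed.

(** Completeness is read off from trace preservation: conjugation by [W] and the partial trace keep
    the trace of every [X], and the trace pairing is nondegenerate. *)
Lemma reservoir_kraus_isom m n (W : 'M[C]_(m * n)) (P tau : 'M[C]_n) g :
  diagonalizes P g tau -> (forall i, 0 <= g 0 i) -> \tr tau = 1 ->
  W \is unitarymx ->
  \sum_x (reservoir_kraus W P g x)^! *m reservoir_kraus W P g x = 1%:M.
Proof.
move=> Pg g0 t1 Wu; apply: mxtrace_inj => X.
have -> : \tr (X *m 1%:M) = \tr (kraus (reservoir_kraus W P g) X).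
  rewrite mulmx1 -(ptrace2_kraus W X Pg g0) mxtrace_ptrace2T [RHS]mxtrace_mulC mulmxA.
  by rewrite (unitarymx_adjmul Wu) mul1mx mxtrace_tens t1 mulr1.
rewrite -[kraus _ X]mul1mx mxtrace_kraus mxtrace_mulC; congr (\tr (_ *m _)).
by apply: eq_bigr => x _; rewrite mulmx1.
Qed.

Lemma psd_diagonalizes n (A : 'M[C]_n) : A^! = A ->
  (forall v : 'rV[C]_n, 0 <= complex.Re (\tr (v *m A *m v^!))) ->
  exists P p, diagonalizes P p A /\ forall i, 0 <= p 0 i.
Proof.
move=> /hermsymmx_adj /spectral_diagonalizes.
set P := spectralmx A; set p := map_mx _ _ => Pp psd; exists P, p; split=> // i.
have := psd (row i P).
have -> : \tr (row i P *m A *m (row i P)^!) = (P *m A *m P^!) i i.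
  rewrite trace_mx11 -row_mul mxE [RHS]mxE; apply: eq_bigr => j _.
  by rewrite !adjmxE !mxE.
by rewrite (diagonalizesE Pp) rdiagE eqxx.
Qed.

(** Klein's inequality as monotonicity under the trace, a channel to 1 x 1 matrices whose Kraus
    operators are the basis row vectors; both states become 1, with relative entropy 0. *)
Lemma relent_ge0 n (P Q rho sigma : 'M[C]_n) p q :
  diagonalizes P p rho -> diagonalizes Q q sigma ->
  (forall i, 0 <= p 0 i) -> (forall i, 0 <= q 0 i) ->
  (forall j, q 0 j = 0 -> complex.Re ((Q *m rho *m Q^!) j j) = 0) ->
  \tr rho = 1 -> \tr sigma = 1 -> 0 <= relent P Q p q.
Proof.
move=> Pp Qq p0 q0 supp r1 s1.
pose A (k : 'I_n) : 'M[C]_(1, n) := delta_mx 0 k.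
have A1 : \sum_k (A k)^! *m A k = 1%:M.
  have adjA k : (A k)^! = delta_mx k 0.
    by apply/matrixP => i j; rewrite adjmxE !mxE andbC rmorph_nat.
  rewrite mx1_sum_delta; apply: eq_bigr => k _.
  by rewrite adjA mul_delta_mx.
have trA X : \tr X = 1 -> kraus A X = 1%:M.
  move=> X1; rewrite [kraus A X]mx11_scalar; congr (_%:M).
  by rewrite -trace_mx11 (mxtrace_krausT A1).
have D1 : diagonalizes (1%:M : 'M[C]_1) (const_mx 1) (1%:M : 'M[C]_1).
  split; first by apply: unitary_of_mulmx; rewrite adjmx1 mul1mx.
  rewrite adjmx1 mul1mx mulmx1; apply/matrixP => i j.
  by rewrite rdiagE !mxE.
have := @relent_kraus _ _ _ A _ _ _ _ _ _ 1%:M 1%:M (const_mx 1) (const_mx 1) A1 Pp Qq.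
rewrite !trA // => /(_ D1 D1 p0 q0).
have -> : relent (1%:M : 'M[C]_1) 1%:M (const_mx 1) (const_mx 1) = 0.
  by rewrite /relent big1 // => j _; rewrite big1 // => i _; rewrite !mxE subrr mulr0.
apply => // i; rewrite ?mxE // => /eqP; by rewrite oner_eq0.
Qed.

(** * Logarithms of product reference states *)

Section Logsum.
Variables (m n : nat) (O omega : 'M[C]_(m * n)) (w : 'rV[R]_(m * n)).
Variables (Q1 : 'M[C]_m) (Q2 : 'M[C]_n) (q1 : 'rV[R]_m) (q2 : 'rV[R]_n).
Hypotheses (Ow : diagonalizes O w omega) (w0 : forall i, 0 <= w 0 i).
Hypotheses (Q1u : Q1 \is unitarymx) (Q2u : Q2 \is unitarymx).
Hypotheses (q10 : forall i, 0 <= q1 0 i) (q20 : forall i, 0 <= q2 0 i).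

(** [r] holds the joint weights of [omega] measured in the product basis; [r1] and [r2] are its
    marginals. *)
Let r1 a := complex.Re ((Q1 *m ptrace2 omega *m Q1^!) a a).
Let r2 b := complex.Re ((Q2 *m ptrace1 omega *m Q2^!) b b).
Let Q := tensmx Q1 Q2.
Let r a b := complex.Re ((Q *m omega *m Q^!) (mxtens_index (a, b)) (mxtens_index (a, b))).

Hypothesis q1_supp : forall a, q1 0 a = 0 -> r1 a = 0.
Hypothesis q2_supp : forall b, q2 0 b = 0 -> r2 b = 0.

Let r_ge0 a b : 0 <= r a b.
Proof.
rewrite /r -(overlap_row Q Ow); apply: sumr_ge0 => i _.
by rewrite mulr_ge0 ?sqnorm_ge0.
Qed.

Let r_sum1 a : \sum_b r a b = r1 a.
Proof.
by rewrite /r1 -(ptrace2_conj _ _ (unitarymx_adjmul Q2u)) mxE Re_sum.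
Qed.

Let r_sum2 b : \sum_a r a b = r2 b.
Proof.
by rewrite /r2 -(ptrace1_conj _ _ (unitarymx_adjmul Q1u)) mxE Re_sum.
Qed.

Let r_supp a b : q1 0 a = 0 \/ q2 0 b = 0 -> r a b = 0.
Proof.
case=> [/q1_supp|/q2_supp].
  by rewrite -r_sum1 => /psumr_eq0P; apply.
by rewrite -r_sum2 => /psumr_eq0P; apply.
Qed.

(** A zero product has a zero factor, whose marginal weight vanishes; joint weights are nonnegative,
    so they vanish as well. *)
Lemma tens_supp j : tens_diag q1 q2 0 j = 0 -> complex.Re ((Q *m omega *m Q^!) j j) = 0.
Proof.
case: (mxtens_indexP j) => a b; rewrite tens_diagE => /eqP; rewrite mulf_eq0 => h.
by apply: r_supp; case/orP: h => /eqP; [left|right].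
Qed.

(** The logarithm of a product splits and the joint weights sum to the marginals. Where an
    eigenvalue is 0 the logarithm need not split, but the joint weight is 0. *)
Lemma sum_ln_tens : \sum_j complex.Re ((Q *m omega *m Q^!) j j) * ln (tens_diag q1 q2 0 j)
  = \sum_a r1 a * ln (q1 0 a) + \sum_b r2 b * ln (q2 0 b).
Proof.
rewrite sum_mxtens; under [X in _ + X]eq_bigr do rewrite -r_sum2 mulr_suml.
rewrite [X in _ + X]exchange_big -big_split; apply: eq_bigr => a _ /=.
rewrite -r_sum1 mulr_suml -big_split; apply: eq_bigr => b _ /=.
rewrite tens_diagE -mulrDr -/(r a b).
have [a0|a0] := eqVneq (q1 0 a) 0; first by rewrite r_supp ?mul0r //; left.
have [b0|b0] := eqVneq (q2 0 b) 0; first by rewrite r_supp ?mul0r //; right.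
by rewrite lnM // posrE lt0r ?a0 ?b0 /=.
Qed.
End Logsum.

Lemma Re_mxtrace_mul_diag n (Q rho : 'M[C]_n) (e : 'rV[R]_n) :
  complex.Re (\tr (rho *m (Q^! *m rdiag e *m Q))) =
  \sum_j complex.Re ((Q *m rho *m Q^!) j j) * e 0 j.
Proof.
rewrite !mulmxA mxtrace_mulC !mulmxA Re_sum; apply: eq_bigr => j _.
by rewrite mul_mx_rdiag mulrC ReZ mulrC.
Qed.

Lemma diagonalizes_entry n (P A : 'M[C]_n) p i :
  diagonalizes P p A -> complex.Re ((P *m A *m P^!) i i) = p 0 i.
Proof. by move/diagonalizesE->; rewrite rdiagE eqxx. Qed.

Lemma vN_entropyE n (P A : 'M[C]_n) p : diagonalizes P p A ->
  vN_entropy A = - \sum_i p 0 i * ln (p 0 i).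
Proof.
move=> Pp; rewrite /vN_entropy (mxfunE _ Pp) Re_mxtrace_mul_diag; congr (- _).
by apply: eq_bigr => i _; rewrite (diagonalizes_entry i Pp) mxE.
Qed.

(** * Positive matrices, mutual information, second law *)

(** Positivity is packaged with spectral data, the form in which entropies are computed. *)
Definition possemidef n (A : 'M[C]_n) :=
  exists P p, diagonalizes P p A /\ forall i, 0 <= p 0 i.

Lemma possemidef_adj n (A : 'M[C]_n) : possemidef A -> A^! = A.
Proof. by case=> P [p [/diagonalizes_herm/hermsymmx_adj]]. Qed.

Lemma possemidef_conj_ge0 m n (Z : 'M[C]_(m, n)) (A : 'M[C]_n) :
  possemidef A -> 0 <= complex.Re (\tr (Z *m A *m Z^!)).
Proof. by case=> P [p [Pp p0]]; exact: mxtrace_conj_ge0 Pp p0. Qed.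

Lemma density_possemidef n (A : 'M[C]_n) : density A -> possemidef A.
Proof.
case=> /hermsymmx_adj hA [psd _]; apply: psd_diagonalizes => // v.
by have := psd v; rewrite trace_mx11 lecE => /andP[].
Qed.

Lemma possemidef_kraus m n (K : finType) (A : K -> 'M[C]_(m, n)) X :
  possemidef X -> possemidef (kraus A X).
Proof.
move=> pX; apply: psd_diagonalizes => [|v].
  rewrite adjmx_sum; apply: eq_bigr => k _.
  by rewrite !adjmxM adjmxK (possemidef_adj pX) mulmxA.
rewrite mulmx_sumr mulmx_suml (raddf_sum (@mxtrace _ _)) Re_sum.
apply: sumr_ge0 => k _ /=.
have -> : v *m (A k *m X *m (A k)^!) *m v^! = (v *m A k) *m X *m (v *m A k)^!.
  by rewrite adjmxM !mulmxA.
exact: possemidef_conj_ge0.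
Qed.

(** By duality, the quadratic form of the marginal at [v] is the trace of [X] conjugated by
    [tensmx v 1%:M]. *)
Lemma possemidef_ptrace2 m n (X : 'M[C]_(m * n)) : possemidef X -> possemidef (ptrace2 X).
Proof.
move=> pX; apply: psd_diagonalizes => [|v]; first exact/herm_ptrace2/possemidef_adj.
have := possemidef_conj_ge0 (tensmx v 1%:M) pX.
rewrite adjmx_tens mxtrace_mulC mulmxA tensmx_mul adjmx1 mul1mx -mxtrace_ptrace2.
by rewrite [X in _ -> 0 <= complex.Re X]mxtrace_mulC mulmxA.
Qed.

Lemma possemidef_ptrace1 m n (X : 'M[C]_(m * n)) : possemidef X -> possemidef (ptrace1 X).
Proof.
move=> pX; apply: psd_diagonalizes => [|v]; first exact/herm_ptrace1/possemidef_adj.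
have := possemidef_conj_ge0 (tensmx 1%:M v) pX.
rewrite adjmx_tens mxtrace_mulC mulmxA tensmx_mul adjmx1 mul1mx -mxtrace_ptrace1.
by rewrite [X in _ -> 0 <= complex.Re X]mxtrace_mulC mulmxA.
Qed.

Lemma tens_diag_ge0 m n (p : 'rV[R]_m) (q : 'rV[R]_n) :
  (forall i, 0 <= p 0 i) -> (forall j, 0 <= q 0 j) -> forall k, 0 <= tens_diag p q 0 k.
Proof. by move=> p0 q0 k; rewrite mxE mulr_ge0. Qed.

Definition mutual_info m n (rho : 'M[C]_(m * n)) : R :=
  vN_entropy (ptrace2 rho) + vN_entropy (ptrace1 rho) - vN_entropy rho.

Section MutualInfo.
Variables (m n : nat) (P rho : 'M[C]_(m * n)) (p : 'rV[R]_(m * n)).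
Variables (P1 : 'M[C]_m) (p1 : 'rV[R]_m) (P2 : 'M[C]_n) (p2 : 'rV[R]_n).
Hypotheses (Pp : diagonalizes P p rho) (p0 : forall i, 0 <= p 0 i).
Hypotheses (Pp1 : diagonalizes P1 p1 (ptrace2 rho)) (p10 : forall i, 0 <= p1 0 i).
Hypotheses (Pp2 : diagonalizes P2 p2 (ptrace1 rho)) (p20 : forall i, 0 <= p2 0 i).

Let s1 a : p1 0 a = 0 -> complex.Re ((P1 *m ptrace2 rho *m P1^!) a a) = 0.
Proof. by rewrite (diagonalizes_entry a Pp1). Qed.

Let s2 b : p2 0 b = 0 -> complex.Re ((P2 *m ptrace1 rho *m P2^!) b b) = 0.
Proof. by rewrite (diagonalizes_entry b Pp2). Qed.

Lemma marginals_supp j : tens_diag p1 p2 0 j = 0 ->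
  complex.Re ((tensmx P1 P2 *m rho *m (tensmx P1 P2)^!) j j) = 0.
Proof. exact: (tens_supp Pp p0 Pp1.1 Pp2.1 s1 s2). Qed.

(** Mutual information is the relative entropy to the product of the marginals: [sum_ln_tens] splits
    the cross term into the two marginal entropies. *)
Lemma relent_marginals : relent P (tensmx P1 P2) p (tens_diag p1 p2) = mutual_info rho.
Proof.
rewrite (relentE _ Pp (unitary_tens Pp1.1 Pp2.1)).
rewrite (sum_ln_tens Pp p0 Pp1.1 Pp2.1 p10 p20 s1 s2) /mutual_info.
rewrite (vN_entropyE Pp) (vN_entropyE Pp1) (vN_entropyE Pp2).
under [X in _ - (X + _)]eq_bigr do rewrite (diagonalizes_entry _ Pp1).
under [X in _ - (_ + X)]eq_bigr do rewrite (diagonalizes_entry _ Pp2).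
by ring.
Qed.
End MutualInfo.

Section LocalKraus.
Variables (m m' n : nat) (K : finType) (A : K -> 'M[C]_(m', m)).
Hypothesis A_isom : \sum_k (A k)^! *m A k = 1%:M.

Definition local_kraus (k : K) : 'M[C]_(m' * n, m * n) := tensmx (A k) 1%:M.

Let tens_suml (B : K -> 'M[C]_m) (Y : 'M[C]_n) :
  \sum_k tensmx (B k) Y = tensmx (\sum_k B k) Y.
Proof.
by apply/matrixP => i j; rewrite summxE !mxE summxE mulr_suml; apply: eq_bigr => k _; rewrite mxE.
Qed.

Lemma local_kraus_isom : \sum_k (local_kraus k)^! *m local_kraus k = 1%:M.
Proof.
under eq_bigr do rewrite adjmx_tens adjmx1 tensmx_mul mul1mx.
by rewrite tens_suml A_isom tensmx11.
Qed.

Lemma kraus_local_tens X Y : kraus local_kraus (tensmx X Y) = tensmx (kraus A X) Y.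
Proof.
apply/matrixP => i j; rewrite summxE mxE summxE mulr_suml; apply: eq_bigr => k _.
by rewrite adjmx_tens adjmx1 !tensmx_mul mul1mx mulmx1 mxE.
Qed.

Lemma ptrace2_local_kraus X : ptrace2 (kraus local_kraus X) = kraus A (ptrace2 X).
Proof.
apply: mxtrace_inj => Y; rewrite mxtrace_ptrace2 !mxtrace_kraus mxtrace_ptrace2.
congr (\tr (_ *m X)); rewrite -tens_suml; apply: eq_bigr => k _.
by rewrite adjmx_tens adjmx1 !tensmx_mul !mul1mx.
Qed.

(** No signalling: the dual map is unital, so it fixes every test matrix [tensmx 1%:M Y]. *)
Lemma ptrace1_local_kraus X : ptrace1 (kraus local_kraus X) = ptrace1 X.
Proof.
apply: mxtrace_inj => Y; rewrite !mxtrace_ptrace1 mxtrace_kraus.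
congr (\tr (_ *m X)); rewrite -A_isom -tens_suml; apply: eq_bigr => k _.
by rewrite adjmx_tens adjmx1 !tensmx_mul mulmx1 mul1mx mulmx1.
Qed.

(** A local channel sends the product of the marginals to the product of the new marginals, so
    [relent_kraus] applies to [rho] and that product. The second marginal is unchanged and keeps its
    eigenbasis. *)
Lemma mutual_info_local_kraus rho : possemidef rho ->
  mutual_info (kraus local_kraus rho) <= mutual_info rho.
Proof.
move=> psd; have psd' := possemidef_kraus local_kraus psd.
have psd1 := possemidef_ptrace2 psd; have psd1' := possemidef_ptrace2 psd'.
have psd2 := possemidef_ptrace1 psd.
case: psd => P [p [Pp p0]]; case: psd' => P' [p' [Pp' p0']].
case: psd1 => P1 [p1 [Pp1 p10]]; case: psd1' => P1' [p1' [Pp1' p10']].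
case: psd2 => P2 [p2 [Pp2 p20]].
have Pp2' : diagonalizes P2 p2 (ptrace1 (kraus local_kraus rho)).
  by rewrite ptrace1_local_kraus.
rewrite -(relent_marginals Pp p0 Pp1 p10 Pp2 p20).
rewrite -(relent_marginals Pp' p0' Pp1' p10' Pp2' p20).
have Qq := tens_diagonalizes Pp1 Pp2.
apply: (relent_kraus local_kraus_isom Pp Qq Pp') => //; try exact: tens_diag_ge0.
- by rewrite kraus_local_tens -ptrace2_local_kraus; exact: tens_diagonalizes.
- exact: (marginals_supp Pp p0 Pp1 Pp2).
- exact: (marginals_supp Pp' p0' Pp1' Pp2').
Qed.
End LocalKraus.

(** The last sum is Tr (tau - omega_R) ln tau, with omega_R the final reservoir state. The whole
    expression is D(omega || omega_S (x) tau), with omega_S the final system state; [0 < g] settles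
    the support condition on the reservoir side. *)
Lemma second_law m n (rho : 'M[C]_m) (P tau : 'M[C]_n) (g : 'rV[R]_n) (U : 'M[C]_(m * n))
    (omega := U *m tensmx rho tau *m U^!) :
  possemidef rho -> \tr rho = 1 -> diagonalizes P g tau -> (forall i, 0 < g 0 i) ->
  \tr tau = 1 -> U \is unitarymx ->
  0 <= vN_entropy (ptrace2 omega) - vN_entropy rho +
    \sum_b (g 0 b - complex.Re ((P *m ptrace1 omega *m P^!) b b)) * ln (g 0 b).
Proof.
move=> [P1 [p1 [Pp1 p10]]] r1 Pg g_gt0 t1 Uu.
have g0 i : 0 <= g 0 i by exact: ltW.
have gn0 b (x : R) : g 0 b = 0 -> x = 0 by move=> h; have := g_gt0 b; rewrite h ltxx.
pose O := tensmx P1 P; pose d := tens_diag p1 g.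
have Od : diagonalizes O d (tensmx rho tau) by exact: tens_diagonalizes.
have d0 : forall i, 0 <= d 0 i by exact: tens_diag_ge0.
(* Conjugation by [U] keeps the eigenvalues, so the joint entropy is conserved. *)
have Vd : diagonalizes (O *m U^!) d omega.
  split.
    apply: unitary_of_mulmx; rewrite adjmxM adjmxK -mulmxA (mulmxA U^! U).
    by rewrite (unitarymx_adjmul Uu) mul1mx (unitarymx_mulmx Od.1).
  by rewrite /omega Od.2 adjmxM adjmxK !mulmxA.
have [Pf [pf [Ppf pf0]]] : possemidef (ptrace2 omega).
  by apply: possemidef_ptrace2; exists (O *m U^!), d.
have omega1 : \tr omega = 1.
  rewrite /omega mxtrace_mulC mulmxA (unitarymx_adjmul Uu) mul1mx mxtrace_tens.
  by rewrite r1 t1 mulr1.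
have Qq := tens_diagonalizes Ppf Pg.
have sf a : pf 0 a = 0 -> complex.Re ((Pf *m ptrace2 omega *m Pf^!) a a) = 0.
  by rewrite (diagonalizes_entry a Ppf).
have := relent_ge0 Vd Qq d0 (tens_diag_ge0 pf0 g0)
  (fun j => tens_supp Vd d0 Ppf.1 Pg.1 sf (fun b => @gn0 b _) (j := j)) omega1.
rewrite mxtrace_tens mxtrace_ptrace2T omega1 t1 mulr1 => /(_ erefl).
rewrite (relentE _ Vd Qq.1).
rewrite (sum_ln_tens Vd d0 Ppf.1 Pg.1 pf0 g0 sf (fun b => @gn0 b _)).
(* The prefactor in [d ln d] is read as a diagonal entry of the initial product state, so that
   [sum_ln_tens] splits its entropy as well. *)
under eq_bigr do rewrite -{1}(diagonalizes_entry _ Od).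
have s1 a : p1 0 a = 0 ->
    complex.Re ((P1 *m ptrace2 (tensmx rho tau) *m P1^!) a a) = 0.
  by rewrite ptrace2_tens t1 scale1r (diagonalizes_entry a Pp1).
rewrite (sum_ln_tens Od d0 Pp1.1 Pg.1 p10 g0 s1 (fun b => @gn0 b _)).
rewrite ptrace2_tens ptrace1_tens t1 r1 !scale1r.
under eq_bigr do rewrite (diagonalizes_entry _ Pp1).
under [X in _ + X - _]eq_bigr do rewrite (diagonalizes_entry _ Pg).
under [X in _ - (X + _)]eq_bigr do rewrite (diagonalizes_entry _ Ppf).
rewrite (vN_entropyE Ppf) (vN_entropyE Pp1).
under [X in _ -> 0 <= _ + X]eq_bigr do rewrite mulrBl.
rewrite sumrB; lra.
Qed.

(** * Idle memory and Gibbs reservoir *)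

Section Lift.
Variables (dS dM dR : nat) (U : 'M[C]_(dS * dR)).
Local Notation W := (liftSR (dM := dM) U).

Lemma slice_lift k b : slice W k b = tensmx (slice U k b) 1%:M.
Proof.
apply/matrixP => i j; case: (mxtens_indexP i) => s x; case: (mxtens_indexP j) => s' x'.
by rewrite tensmxE !mxE !mxtens_indexK.
Qed.

(** Since the memory does not evolve, the channel on system and memory is local to the system. *)
Lemma reservoir_kraus_lift P g x :
  reservoir_kraus W P g x = local_kraus dM (reservoir_kraus U P g) x.
Proof.
apply/matrixP => i j; rewrite summxE mxE summxE mulr_suml; apply: eq_bigr => b _.
by rewrite slice_lift !mxE mulrA.
Qed.

(** The final reservoir state, hence the heat, sees the initial state only through the system
    marginal: in each block the memory factor is the identity and is traced out. *)
Lemma ptrace1_lift (rho : 'M[C]_(dS * dM)) (tau : 'M[C]_dR) :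
  ptrace1 (W *m tensmx rho tau *m W^!) =
  ptrace1 (U *m tensmx (ptrace2 rho) tau *m U^!).
Proof.
apply/matrixP => k l; rewrite [LHS]mxE [RHS]mxE.
under eq_bigr do rewrite conj_slice.
under [RHS]eq_bigr do rewrite conj_slice.
rewrite exchange_big [RHS]exchange_big; apply: eq_bigr => b _ /=.
rewrite exchange_big [RHS]exchange_big; apply: eq_bigr => d _ /=.
rewrite -!mulr_sumr; congr (_ * _); rewrite -!/(mxtrace _) !slice_lift.
rewrite adjmx_tens adjmx1 mxtrace_mulC mulmxA tensmx_mul mul1mx -mxtrace_ptrace2.
by rewrite [RHS]mxtrace_mulC mulmxA.
Qed.
End Lift.

(** The Gibbs state shares the eigenbasis of [H], and the logarithms of its eigenvalues are affine
    in the energies, which turns entropy into heat. A nonempty spectrum makes the partition function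
    positive. *)
Lemma gibbs_diagonalizes n beta (H : 'M[C]_n) P h : (0 < n)%N ->
  diagonalizes P h H ->
  exists g lnZ, [/\ diagonalizes P g (gibbs beta H), forall i, 0 < g 0 i,
    forall i, ln (g 0 i) = - (beta * h 0 i) - lnZ & \tr (gibbs beta H) = 1].
Proof.
move=> n0 Ph; pose e : 'rV[R]_n := map_mx (fun x => expR (- (beta * x))) h.
pose Z := \sum_i e 0 i.
have e0 i : 0 < e 0 i by rewrite mxE expR_gt0.
have Z0 : 0 < Z.
  rewrite /Z (bigD1 (Ordinal n0)) //= ltr_pwDl //.
  by apply: sumr_ge0 => i _; exact: ltW.
have trE : \tr (P^! *m rdiag e *m P) = Z%:C.
  rewrite mxtrace_conj ?Ph.1 // /mxtrace rmorph_sum; apply: eq_bigr => i _.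
  by rewrite rdiagE eqxx.
have gE : gibbs beta H = (Z%:C)^-1 *: (P^! *m rdiag e *m P).
  by rewrite /gibbs (mxfunE _ Ph) -/e trE.
exists (Z^-1 *: e), (ln Z); split.
- split; first exact: Ph.1.
  have -> : rdiag (Z^-1 *: e) = (Z%:C)^-1 *: rdiag e.
    apply/matrixP => i j; rewrite rdiagE [in RHS]mxE rdiagE mxE rmorphM fmorphV.
    by rewrite mulrnAr.
  by rewrite -scalemxAr -scalemxAl.
- by move=> i; rewrite mxE mulr_gt0 ?invr_gt0.
- move=> i; rewrite mxE lnM ?posrE ?invr_gt0 // lnV ?posrE // mxE expRK; ring.
- rewrite gE mxtraceZ trE mulVf //.
  by rewrite (fmorph_eq0 (real_complex R)) gt_eqF.
Qed.

End EntropyProduction.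

Theorem theorem1 (R : realType) (dS dM dR : nat) (hdR : (0 < dR)%N)
  (rhoSM_i : 'M[R[i]]_(dS * dM)) (H : 'M[R[i]]_dR) (beta : R)
  (U : 'M[R[i]]_(dS * dR)) :
  density rhoSM_i -> H \is hermsymmx -> 0 < beta -> U \is unitarymx ->
  let rhoR_i := gibbs beta H in
  let rhoSMR_i := tensmx rhoSM_i rhoR_i in
  let W := liftSR (dM := dM) U in
  let rhoSMR_f := W *m rhoSMR_i *m adjmx W in
  let rhoSM_f := ptrace2 rhoSMR_f in
  let rhoR_f := ptrace1 rhoSMR_f in
  let rhoS_i := ptrace2 rhoSM_i in
  let rhoS_f := ptrace2 rhoSM_f in
  let Q_R := complex.Re (\tr ((rhoR_f - rhoR_i) *m H)) in
  let Sigma_S := vN_entropy rhoS_f - vN_entropy rhoS_i + beta * Q_R in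
  let Sigma_SM := cond_entropy rhoSM_f - cond_entropy rhoSM_i + beta * Q_R in
  Sigma_S <= Sigma_SM /\ 0 <= Sigma_S.
Proof.
move=> dens hH _ Uu tau rho0 W rhof rhoSMf rhoRf rhoSi rhoSf QR SS SSM.
have psd := density_possemidef dens.
have tr1 : \tr rhoSM_i = 1 by case: dens => _ [].
have Ph := spectral_diagonalizes hH.
have [g [lnZ [Pg g_gt0 lng t1]]] := gibbs_diagonalizes beta hdR Ph.
have g0 b : 0 <= g 0 b by exact: ltW.
set P := spectralmx H in Ph Pg; set h := map_mx _ _ in Ph lng.
pose A := reservoir_kraus U P g.
have A1 := reservoir_kraus_isom Pg g0 t1 Uu.
have rhoSMfE : rhoSMf = kraus (local_kraus dM A) rhoSM_i.
  rewrite /rhoSMf /rhof /rho0 (ptrace2_kraus _ _ Pg g0).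
  by apply: eq_bigr => x _; rewrite reservoir_kraus_lift.
split.
  have := mutual_info_local_kraus A1 psd; rewrite -rhoSMfE /mutual_info.
  rewrite /SS /SSM /cond_entropy -/rhoSf -/rhoSi.
  have -> : ptrace1 rhoSMf = ptrace1 rhoSM_i by rewrite rhoSMfE ptrace1_local_kraus.
  move: (vN_entropy rhoSf) (vN_entropy rhoSi) (vN_entropy _) (vN_entropy _) (vN_entropy _).
  by move=> *; lra.
(* For the second inequality the memory can be discarded: both final marginals are those of
   [omega]. *)
pose omega := U *m tensmx rhoSi tau *m adjmx U.
have rhoSfE : rhoSf = ptrace2 omega.
  by rewrite /rhoSf rhoSMfE ptrace2_local_kraus /omega (ptrace2_kraus _ _ Pg g0).
have rhoRfE : rhoRf = ptrace1 omega by rewrite /rhoRf ptrace1_lift.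
have trS : \tr rhoSi = 1 by rewrite mxtrace_ptrace2T.
have := second_law (possemidef_ptrace2 psd) trS Pg g_gt0 t1 Uu.
rewrite -/rhoSi -/omega -rhoSfE -rhoRfE => /le_trans; apply.
(* What remains is an equality: the reservoir term of [second_law] is [beta] times the heat. *)
rewrite /SS lerD2l le_eqVlt; apply/orP; left; apply/eqP.
pose r b := complex.Re ((P *m rhoRf *m adjmx P) b b).
have QE : QR = \sum_b (r b - g 0 b) * h 0 b.
  rewrite /QR {1}Ph.2 Re_mxtrace_mul_diag; apply: eq_bigr => b _.
  rewrite mulmxBr mulmxBl mxE [X in _ + X]mxE ReB; congr ((_ - _) * _).
  exact: diagonalizes_entry.
have sum_g : \sum_b g 0 b = 1.
  transitivity (complex.Re (\tr tau)); last by rewrite t1.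
  rewrite -(overlap_mass Pg Pg.1) exchange_big; apply: eq_bigr => b _.
  by rewrite -mulr_suml (overlap_colsum Pg Pg.1) mul1r.
have sum_r : \sum_b r b = 1.
  rewrite /r -Re_sum -/(mxtrace _) mxtrace_mulC mulmxA (unitarymx_adjmul Ph.1) mul1mx.
  rewrite rhoRfE mxtrace_ptrace1T /omega mxtrace_mulC mulmxA (unitarymx_adjmul Uu) mul1mx.
  by rewrite mxtrace_tens trS t1 mulr1.
rewrite QE mulr_sumr.
(* The added terms in [lnZ] cancel in total because both reservoir states have trace 1; they match
   the constant in [ln (g 0 b)]. *)
have -> : \sum_b beta * ((r b - g 0 b) * h 0 b) =
    \sum_b (beta * ((r b - g 0 b) * h 0 b) + lnZ * r b - lnZ * g 0 b).
  by rewrite sumrB big_split /= -!mulr_sumr sum_g sum_r addrK.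
by apply: eq_bigr => b _; rewrite lng -/(r b); ring.
Qed.
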